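(* Let $h\ge 0$ and let $(G,D)$ be a finite $3$-transposition group of type $3^{\bullet h}{:}(2^{\,\cdot}\operatorname{O}^{+}_{8}(2))$. Then the diagram of $(G,D)$ has size $n=120\cdot 3^{h}$ and spectrum $$((\,57\cdot 3^{h}-1;\ [3^{h+2}-1]^{35},\ [-3^{h+1}-1]^{84},\ [-1]^{\star}\,)).$$
   Context: A $3$-transposition group $(G,D)$ is a group $G$ generated by a conjugacy class $D$ of elements of order $2$ such that $|de|\in\{1,2,3\}$ for all $d,e\in D$. Its diagram is the graph with vertex set $D$ in which two elements are adjacent iff their product has order $3$; its size is $n=|D|$. The spectrum is that of the $(0,1)$-adjacency matrix, written $((k;\dots,[r]^c,\dots))$: first the degree $k$ of the (regular) diagram, counted once, then the remaining eigenvalues, $[r]^c$ meaning $r$ with multiplicity $c$; if listed values coincide, their multiplicities are added, and $[r]^\star$ means that $r$ has whatever further multiplicity (possibly zero) is required for the total multiplicity to be $n$. $\operatorname{O}^+_8(2)$ is the isometry group of a nondegenerate quadratic form $q$ on $\mathbb{F}_2^8$ whose maximal totally singular subspaces have dimension $4$, with $3$-transposition class the transvections $x\mapsto x+f(x,v)v$, $q(v)=1$, where $f$ is the associated symplectic form. $2^{\,\cdot}\operatorname{O}^+_8(2)$ denotes the nonsplit extension with a (central) normal subgroup of order $2$ and quotient $\operatorname{O}_8^+(2)$, isomorphic to the Weyl group $W(E_8)$, with $3$-transposition class $E$ the reflections (which map bijectively onto the transvections of $\operatorname{O}_8^+(2)$). $(G,D)$ has type $3^{\bullet h}{:}(2^{\,\cdot}\operatorname{O}^+_8(2))$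 if $G$ has a normal $3$-subgroup $N$ with $|D\cap dN|=3^{h}$ for all $d\in D$ and $(G/N,DN/N)\cong(2^{\,\cdot}\operatorname{O}^+_8(2),E)$. *)

(* Defs.v *)
From HB Require Import structures.
From mathcomp Require Import all_boot all_order all_fingroup all_algebra.
From mathcomp Require Import all_solvable all_field all_character.

Set Implicit Arguments.
Unset Strict Implicit.
Unset Printing Implicit Defensive.

Import GroupScope Order.TTheory GRing.Theory Num.Theory.
Local Open Scope ring_scope.

Section ThreeTranspositions.
Local Open Scope group_scope.
Variable gT : finGroupType.
Implicit Types (G : {group gT}) (D : {set gT}) (d e : gT).

Definition three_transposition_group G D : Prop :=
  [/\ D \in classes G,
      <<D>> = G,
      forall d, d \in D -> #[d] = 2
    & forall d e, d \in D -> e \in D -> #[d * e] \in [:: 1; 2; 3]%N].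

Definition diagram : rel gT := fun d e => #[d * e] == 3.

End ThreeTranspositions.

Section Spectrum.
Variables (gT : finGroupType) (D : {set gT}).

Definition diagram_adjmx : 'M[algC]_#|D| :=
  \matrix_(i, j) (diagram (enum_val i) (enum_val j))%:R.

Definition diagram_regular (k : int) : Prop :=
  forall d, d \in D -> #|[set e in D | diagram d e]| = k :> int.

(* [diagram_spectrum k [:: (r1, c1); ...; (rt, ct)] r] is
   ((k; [r1]^c1, ..., [rt]^ct, [r]^* )); multiplicities are those in the
   characteristic polynomial, and [m] is the multiplicity denoted by the star. *)
Definition diagram_spectrum (k : int) (rc : seq (int * nat)) (r : int) : Prop :=
  diagram_regular k /\
  exists m : nat,
    let s := k :: flatten [seq nseq x.2 x.1 | x <- rc] ++ nseq m r in
    size s = #|D| /\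
    char_poly diagram_adjmx = \prod_(a <- s) ('X - (a%:~R)%:P).

End Spectrum.

Definition pair_isog (aT rT : finGroupType)
    (A D : {set aT}) (B E : {set rT}) : Prop :=
  exists2 f : {morphism A >-> rT}, isom A B f & f @: D = E.

Section QuadraticForms.
Variables (F : fieldType) (vT : vectType F) (q : vT -> F).

Definition polar (x y : vT) : F := q (x + y) - q x - q y.

(* The polar form is symmetric, so linearity on one side suffices. *)
Definition quadratic_form : Prop :=
  (forall a x, q (a *: x) = a ^+ 2 * q x) /\
  (forall a x y z, polar (a *: x + y) z = a * polar x z + polar y z).

Definition nondegenerate : Prop :=
  forall x, (forall y, polar x y = 0) -> x = 0.

Definition totally_singular (U : {vspace vT}) : Prop :=
  forall x, x \in U -> q x = 0.

Definition maximal_totally_singular (U : {vspace vT}) : Prop :=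
  totally_singular U /\
  (forall W : {vspace vT}, totally_singular W -> (U <= W)%VS -> W = U).

End QuadraticForms.

Definition form_O8plus2 (q : 'rV['F_2]_8 -> 'F_2) : Prop :=
  [/\ quadratic_form q, nondegenerate q
    & forall U : {vspace 'rV['F_2]_8},
        maximal_totally_singular q U -> \dim U = 4].

Section IsometryGroup.
Variable q : 'rV['F_2]_8 -> 'F_2.

(* Matrices act on row vectors from the right. *)
Definition isometries : {set {'GL_8['F_2]}} :=
  [set g : {'GL_8['F_2]} | [forall x : 'rV['F_2]_8, q (x *m GLval g) == q x]].

Lemma isometries_group_set : group_set isometries.
Proof.
apply/group_setP; split=> [|g h].
  by rewrite inE; apply/forallP=> x; rewrite GL_1E mulmx1.
rewrite !inE => /forallP qg /forallP qh; apply/forallP=> x.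
by rewrite GL_ME mulmxA (eqP (qh _)).
Qed.

Canonical isometries_group := Group isometries_group_set.

Definition transvections : {set {'GL_8['F_2]}} :=
  [set g : {'GL_8['F_2]} |
    [exists v : 'rV['F_2]_8, (q v == 1) &&
      [forall x : 'rV['F_2]_8, x *m GLval g == x + polar q x v *: v]]].

End IsometryGroup.

(* The root system of type E8 in its standard even coordinates: vectors of
   squared length 2, with all coordinates in Z or all in Z + 1/2, and with
   even coordinate sum. *)
Definition E8_root (a : 'rV[rat]_8) : Prop :=
  [/\ (forall i, a 0 i \is a Num.int) \/ (forall i, a 0 i - 2^-1 \is a Num.int),
      (\sum_i a 0 i) / 2 \is a Num.int
    & \sum_i a 0 i ^+ 2 = 2].

(* The matrix of x |-> x - (x, a) a, the reflection in a vector with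
   (a, a) = 2. *)
Definition root_reflection (a : 'rV[rat]_8) : 'M[rat]_8 := 1%:M - a^T *m a.

Section TwoO8plus2.
Local Open Scope group_scope.
Variables (gT : finGroupType) (H : {group gT}) (E : {set gT}).

(* (H, E) is isomorphic to the linear group over rat generated by the
   reflections in the E8 roots, E corresponding to the reflections. *)
Definition is_weyl_E8 : Prop :=
  <<E>> = H /\
  exists rH : mx_representation rat H 8,
    mx_faithful rH /\
    (forall M : 'M[rat]_8,
       (exists2 d, d \in E & rH d = M) <->
       (exists2 a, E8_root a & root_reflection a = M)).

Definition is_nonsplit_2_O8plus2 : Prop :=
  exists Z : {group gT},
    [/\ Z \subset 'Z(H), #|Z| = 2, ~~ [splits H, over Z],
        {in E &, injective (coset Z)}
      & exists2 q, form_O8plus2 q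
          & pair_isog (H / Z) (E / Z) (isometries q) (transvections q)].

(* The second clause says which class E is, and it determines (H, E) up to
   isomorphism. It implies the first one: W(E8) modulo its centre {1, -1} acts on
   the E8 lattice modulo 2 as the isometry group of the form (x, x) / 2, the
   reflections acting as the transvections. *)
Definition is_2_O8plus2 : Prop := is_nonsplit_2_O8plus2 /\ is_weyl_E8.

End TwoO8plus2.

(* (G, D) has type 3^{bullet h} : (2 . O8+(2)) *)
Definition type_3h_2_O8plus2 (h : nat) (gT : finGroupType)
    (G : {group gT}) (D : {set gT}) : Prop :=
  exists N : {group gT},
    [/\ (N <| G)%g, 3.-group N,
        forall d, d \in D -> #|D :&: (d *: N)%g| = (3 ^ h)%N
      & is_2_O8plus2 (G / N)%G (D / N)%g].

(* Main.v *)
(* Write V for the 8-dimensional quadratic space over F_2, f for its polar form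
   and Q for the 120 vectors v with q(v) = 1. Each d in D is labelled by the
   vector phi(d) in Q of the transvection it induces; every label occurs 3^h
   times. Two distinct elements of D are adjacent exactly when their labels
   coincide (their product then lies in the 3-group N) or are not orthogonal.
   With t = 3^h, P = [phi d = phi e], K = (-1)^f(phi d, phi e) and J the
   all-one matrix, the adjacency matrix plus the identity is P + (J - K) / 2.
   The Gauss sum of (-1)^q(x) over V is 16, because V has a totally singular
   subspace of dimension 4; restricted to Q this gives K J = 8 t J and
   K^2 = 128 t P - 8 t K. Hence P, J and K span a commutative algebra whose four
   primitive idempotents, together with their traces, yield the spectrum. *)
From HB Require Import structures.
Require Import Defs.
From mathcomp Require Import all_boot all_order all_fingroup all_algebra.
From mathcomp Require Import all_solvable all_field all_character.
From mathcomp Require Import ring.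

Set Implicit Arguments.
Unset Strict Implicit.
Unset Printing Implicit Defensive.

Import GroupScope Order.TTheory GRing.Theory Num.Theory.
Local Open Scope ring_scope.

(** * Characteristic polynomials from orthogonal idempotents *)

(** Sylvester's identity: the two sides are the determinants of the two products, in opposite
    orders, of the same pair of block matrices. *)
Lemma det_1addM_mulmxC (R : comNzRingType) m n (A : 'M[R]_(m, n)) (B : 'M[R]_(n, m)) :
  \det (1%:M + A *m B) = \det (1%:M + B *m A).
Proof.
have e1 : block_mx 1%:M (- A) B 1%:M *m block_mx 1%:M A 0 1%:M
          = block_mx 1%:M 0 B (1%:M + B *m A).
  by rewrite mulmx_block !mulmx1 !mul1mx !mulmx0 addr0 subrr addr0 addrC.
have e2 : block_mx 1%:M A 0 1%:M *m block_mx 1%:M (- A) B 1%:M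
          = block_mx (1%:M + A *m B) 0 B 1%:M.
  by rewrite mulmx_block !mulmx1 !mul1mx !mul0mx !add0r addNr.
have := congr1 determinant e1; have := congr1 determinant e2.
by rewrite !det_mulmx !det_ublock !det_lblock !det1 !mulr1 !mul1r => <- <-.
Qed.

(** In the rank factorisation [E = col_base E *m row_base E] both factors have full rank, so they
    can be cancelled from the two ends of [E *m E = E]. *)
Lemma idempotent_base (F : fieldType) n (E : 'M[F]_n) :
  E *m E = E -> row_base E *m col_base E = 1%:M.
Proof.
move=> EE.
apply: (row_free_inj (row_base_free E)).
apply: (row_full_inj (col_base_full E)) => /=.
by rewrite mul1mx -(mulmxA (row_base E)) mulmx_base (mulmxA (col_base E)) mulmx_base.
Qed.

Lemma mxtrace_idempotent (F : fieldType) n (E : 'M[F]_n) :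
  E *m E = E -> \tr E = (\rank E)%:R.
Proof.
by move=> EE; rewrite -[E in LHS]mulmx_base mxtrace_mulC idempotent_base // mxtrace1.
Qed.

(** Sylvester's identity moves the determinant to size [\rank E], where the matrix becomes the
    scalar [c]. *)
Lemma det_1add_idempotent (F : fieldType) n (E : 'M[F]_n) (c : {poly F}) :
  E *m E = E -> \det (1%:M + (c - 1) *: map_mx polyC E) = c ^+ \rank E.
Proof.
move=> EE; rewrite -[E in map_mx _ E]mulmx_base map_mxM scalemxAl.
rewrite det_1addM_mulmxC -scalemxAr -map_mxM idempotent_base // map_mx1.
by rewrite -{1}[1%:M]scale1r -scalerDl [1 + _]addrC subrK detZ det1 mulr1.
Qed.

(** Since the [E i] sum to 1, the characteristic matrix is 1 plus the sum of the (c i - 1) E i; by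
    orthogonality this is the product of the factors 1 + (c i - 1) E i. *)
Lemma char_poly_idempotents (F : fieldType) n (I : finType)
    (E : I -> 'M[F]_n) (r : I -> F) :
  (forall i, E i *m E i = E i) -> (forall i j, i != j -> E i *m E j = 0) ->
  \sum_i E i = 1%:M ->
  char_poly (\sum_i r i *: E i) = \prod_i ('X - (r i)%:P) ^+ \rank (E i).
Proof.
move=> EE E0 E1; pose c i := 'X - (r i)%:P.
have det_sum (s : seq I) : uniq s ->
    \det (1%:M + \sum_(i <- s) (c i - 1) *: map_mx polyC (E i))
      = \prod_(i <- s) c i ^+ \rank (E i).
  elim: s => [_|i s IHs /andP[i_s s_uniq]]; first by rewrite !big_nil addr0 det1.
  rewrite !big_cons -IHs // -det_1add_idempotent // -det_mulmx; congr (\det _).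
  rewrite mulmxDr mulmx1 mulmxDl mul1mx mulmx_sumr [X in _ + (_ + X)]big1_seq ?addr0 ?addrA //.
  move=> j /andP[_ j_s]; rewrite -scalemxAl -scalemxAr -map_mxM E0 ?map_mx0 ?scaler0 //.
  by apply: contraNneq i_s => ->.
rewrite -det_sum ?index_enum_uniq //; congr (\det _).
have sum1 : 1%:M = \sum_i map_mx polyC (E i) by rewrite -(map_mx1 polyC) -E1 raddf_sum.
have sumr : map_mx polyC (\sum_i r i *: E i) = \sum_i (r i)%:P *: map_mx polyC (E i).
  by rewrite raddf_sum; apply: eq_bigr => i _; rewrite -map_mxZ.
rewrite /char_poly_mx sumr sum1 -(scalemx1 _ 'X) sum1 scaler_sumr -sumrB -big_split.
apply: eq_bigr => i _ /=.
by rewrite -scalerBl -[X in _ = X + _]scale1r -scalerDl [1 + _]addrC subrK.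
Qed.

(** Here [p], [j], [k] stand for P / t, J / (120 t), K / t; this scaling makes [p] and [j]
    idempotent and removes t from the relations. *)
Lemma char_poly_projections (F : numFieldType) n (p j k : 'M[F]_n) (t : F) :
  p *m p = p -> j *m j = j -> p *m j = j -> j *m p = j ->
  p *m k = k -> k *m p = k -> j *m k = 8 *: j -> k *m j = 8 *: j ->
  k *m k = 128 *: p - 8 *: k ->
  \tr p = 120 -> \tr j = 1 -> \tr k = 120 ->
  exists2 m, n = (120 + m)%N &
    char_poly (t *: (p + 60 *: j - 2^-1 *: k) - 1%:M)
      = ('X - (57 * t - 1)%:P) * ('X - (9 * t - 1)%:P) ^+ 35
        * ('X - (- (3 * t) - 1)%:P) ^+ 84 * ('X + 1) ^+ m.
Proof.
move=> pp jj pj jp pk kp jk kj kk trp trj trk.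
(* On the image of p, the eigenvalues of k are -16 (projection E1) and 8; the
   eigenvalue 8 splits into the images of j and E2. *)
pose E0 := 1%:M - p; pose E1 := 24^-1 *: (8 *: p - k).
pose E2 := 24^-1 *: (16 *: p + k) - j.
have lin := (mulmxDl, mulmxDr, mulmxBl, mulmxBr, mulmxN, mulNmx, mulmx1, mul1mx).
have mulE := (pp, jj, pj, jp, pk, kp, jk, kj, kk).
pose E (i : 'I_4) := [:: j; E1; E2; E0]`_i.
(* On the image of [j], [E1], [E2] the matrix [k] acts as 8, -16, 8, so p + 60 j - k / 2 acts as 1 +
   60 - 4, 1 + 8, 1 - 4; on that of [E0] it is 0. *)
pose r (i : 'I_4) := [:: 57 * t - 1; 9 * t - 1; - (3 * t) - 1; -1]`_i.
have EE i : E i *m E i = E i.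
  case: i => [[|[|[|[|//]]]] ?]; rewrite /E /= /E0 /E1 /E2
    ?lin -?scalemxAl -?scalemxAr ?lin -?scalemxAl -?scalemxAr ?mulE;
    apply/matrixP => a b; rewrite ?mxE; by field.
have EN i i' : i != i' -> E i *m E i' = 0.
  case: i => [[|[|[|[|//]]]] ?]; case: i' => [[|[|[|[|//]]]] ?] // _; rewrite /E /= /E0 /E1 /E2
    ?lin -?scalemxAl -?scalemxAr ?lin -?scalemxAl -?scalemxAr ?mulE;
    apply/matrixP => x y; rewrite ?mxE; by field.
have sumE : \sum_i E i = 1%:M.
  rewrite !big_ord_recl big_ord0 /E /= /E0 /E1 /E2.
  by apply/matrixP => a b; rewrite ?mxE; by field.
have -> : t *: (p + 60 *: j - 2^-1 *: k) - 1%:M = \sum_i r i *: E i.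
  rewrite !big_ord_recl big_ord0 /E /r /= /E0 /E1 /E2.
  by apply/matrixP => a b; rewrite ?mxE; by field.
(* In characteristic 0 the trace of an idempotent determines its rank: (8 * 120 - 120) / 24 = 35 and
   (16 * 120 + 120) / 24 - 1 = 84. *)
have rankE (X : 'M[F]_n) c : X *m X = X -> \tr X = c%:R -> \rank X = c.
  by move=> XX; rewrite mxtrace_idempotent // => /eqP; rewrite eqr_nat => /eqP.
have rankj : \rank j = 1%N by exact: rankE.
have rank1 : \rank E1 = 35%N.
  apply: rankE; first exact: (EE (Ordinal (isT : (1 < 4)%N))).
  by rewrite /E1 linearZ linearB linearZ /= trp trk; field.
have rank2 : \rank E2 = 84%N.
  apply: rankE; first exact: (EE (Ordinal (isT : (2 < 4)%N))).
  by rewrite /E2 linearB linearZ linearD linearZ /= trp trj trk; field.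
exists (\rank E0).
  have : \tr E0 = (\rank E0)%:R.
    by apply: mxtrace_idempotent; exact: (EE (Ordinal (isT : (3 < 4)%N))).
  by rewrite linearB /= mxtrace1 trp => /eqP; rewrite subr_eq -natrD eqr_nat addnC => /eqP.
rewrite char_poly_idempotents // !big_ord_recl big_ord0 /E /r /=.
by rewrite rankj rank1 rank2 expr1 polyCN opprK mulr1 !mulrA.
Qed.

(** * Character sums of the quadratic form *)

(** The nontrivial additive character of F_2; the exponent is the representative 0 or 1 of [x]. *)
Definition chi (x : 'F_2) : algC := (-1) ^+ x.

Lemma F2_natE (x : 'F_2) : x = (x != 0)%:R.
Proof. by apply: val_inj; case: x => [[|[|//]] ?]. Qed.

Lemma F2_neq0 (x : 'F_2) : (x != 0) = (x == 1).
Proof. by case: x => [[|[|//]] ?]. Qed.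

Lemma F2_addrr (x : 'F_2) : x + x = 0.
Proof. exact: addrr_pchar2 (pchar_Fp _) x. Qed.

Lemma F2_rV_addrr n (x : 'rV['F_2]_n) : x + x = 0.
Proof. by rewrite -mulr2n -scaler_nat (_ : 2%:R = 0) ?scale0r //; apply: val_inj. Qed.

Lemma chi0 : chi 0 = 1. Proof. by []. Qed.

Lemma chi1 : chi 1 = -1. Proof. by rewrite /chi expr1. Qed.

Lemma chiD x y : chi (x + y) = chi x * chi y.
Proof.
rewrite [x]F2_natE [y]F2_natE; case: (x != 0); case: (y != 0);
  by rewrite ?addr0 ?add0r ?chi0 ?chi1 ?mulr1 ?mul1r ?mulrNN ?mulr1.
Qed.

Lemma chiE x : chi x = if x == 0 then 1 else -1.
Proof. by rewrite [x]F2_natE; case: (x != 0); rewrite ?chi1. Qed.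

Section QuadraticForm.
Variable q : 'rV['F_2]_8 -> 'F_2.
Hypothesis q_quad : quadratic_form q.
Local Notation f := (polar q).

Lemma quad0 : q 0 = 0.
Proof. by rewrite -(scale0r 0) q_quad.1 expr0n mul0r. Qed.

Lemma polarC x y : f x y = f y x.
Proof. by rewrite /polar [x + y]addrC addrAC. Qed.

Lemma polarDl x y z : f (x + y) z = f x z + f y z.
Proof. by rewrite -[x in LHS]scale1r q_quad.2 mul1r. Qed.

Lemma polarDr x y z : f x (y + z) = f x y + f x z.
Proof. by rewrite ![f x _]polarC polarDl. Qed.

Lemma polar0r x : f x 0 = 0.
Proof. by apply: (addrI (f x 0)); rewrite -polarDr !addr0. Qed.

Lemma polarZl a x z : f (a *: x) z = a * f x z.
Proof. by rewrite -[a *: x]addr0 q_quad.2 [f 0 z]polarC polar0r addr0. Qed.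

Lemma polarxx x : f x x = 0.
Proof. by rewrite /polar F2_rV_addrr quad0 sub0r; case: (q x) => [[|[|//]] ?]; apply: val_inj. Qed.

Lemma quadD x y : q (x + y) = q x + q y + f x y.
Proof. by rewrite /polar; ring. Qed.

(** Translation by [y] permutes the summands and multiplies each by [chi (f y u)] = -1, so the sum
    equals its own negative. *)
Lemma sum_chi_shift (P : pred 'rV['F_2]_8) u y :
  (forall x, P (x + y) = P x) -> f y u != 0 -> \sum_(x | P x) chi (f x u) = 0.
Proof.
move=> Py fyu; set S := \sum_(x | _) _.
suff SN : S = - S by apply/eqP; rewrite -[_ == _](mulrn_eq0 S 2) mulr2n {2}SN subrr.
rewrite {1}/S (reindex_inj (addIr y)) -sumrN; apply: eq_big => x; rewrite ?Py //.
by move=> _; rewrite polarDl chiD [chi (f y u)]chiE (negbTE fyu) mulrN1.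
Qed.

(** [form_O8plus2] only constrains maximal totally singular subspaces, so one has to be produced:
    the zero space is enlarged one vector at a time. *)
Lemma exists_maximal_totally_singular :
  exists U, maximal_totally_singular q U.
Proof.
pose sing (U : {vspace 'rV['F_2]_8}) := [forall x, (x \in U) ==> (q x == 0)].
have singP U : reflect (totally_singular q U) (sing U).
  apply: (iffP forallP) => [sU x xU | sU x]; first exact/eqP/(implyP (sU x)).
  by apply/implyP => xU; rewrite sU.
(* The induction is on a bound [k] for the codimension of [U]. *)
suff ext k U : totally_singular q U -> (8 - \dim U <= k)%N ->
    exists U, maximal_totally_singular q U.
  apply: (ext 8 0%VS); last exact: leq_subr.
  by move=> x; rewrite memv0 => /eqP->; exact: quad0.
elim: k U => [|k IHk] U sU dU.
  exists U; split=> // W _ UW; apply/eqP; rewrite eq_sym eqEdim UW.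
  rewrite (leq_trans (dimvS (subvf W))) // dimvf /dim /= mul1n.
  by rewrite -subn_eq0 -leqn0.
have [/existsP[x /andP[xU sUx]] | noext] :=
    boolP [exists x, (x \notin U) && sing (U + <[x]>)%VS].
  apply: (IHk _ (elimT (singP _) sUx)).
  have := ltn_leqif (dimv_leqif_sup (addvSl U <[x]>%VS)).
  rewrite subv_add subvv /= -memvE xU => /idP lt_dim.
  by rewrite leq_subLR (leq_trans _ (leq_add lt_dim (leqnn k))) // addSnnS -leq_subLR.
exists U; split=> // W sW UW; apply/eqP; rewrite eqEsubv UW andbT.
apply/subvP => x xW; apply: contraNT noext => xU; apply/existsP; exists x.
rewrite xU; apply/singP => y yUx; apply: sW; apply: subvP yUx.
by rewrite subv_add UW -memvE.
Qed.

End QuadraticForm.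

Section PlusType.
Variable q : 'rV['F_2]_8 -> 'F_2.
Hypothesis qO : form_O8plus2 q.
Local Notation f := (polar q).

Let q_quad : quadratic_form q. Proof. by case: qO. Qed.

Lemma polar_neq0 u : u != 0 -> exists x, f x u != 0.
Proof.
move=> u0; apply/existsP; apply: contraNT u0; rewrite negb_exists => /forallP fu.
case: qO => _ nd _; apply/eqP/nd => y; apply/eqP; rewrite polarC.
by have := fu y; rewrite negbK.
Qed.

Lemma sum_chi_polar u : \sum_x chi (f x u) = if u == 0 then 256 else 0.
Proof.
case: eqP => [->|/eqP/polar_neq0[y fyu]]; last exact: (sum_chi_shift _ _ fyu).
under eq_bigr do rewrite polar0r // chi0.
by rewrite sumr_const card_mx card_Fp.
Qed.

(* For a totally singular U of dimension 4, averaging over the cosets of U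
   leaves only the sum over the orthogonal complement of U, which is U. *)
Lemma sum_chi_quad : \sum_x chi (q x) = 16.
Proof.
have [U maxU] := exists_maximal_totally_singular q_quad.
have dU : \dim U = 4 by case: qO => _ _; apply.
have [sU _] := maxU.
have cardU : #|U| = 16%N by rewrite card_vspace card_Fp // dU.
pose T x := \sum_(u in U) chi (f u x).
have TU x : x \in U -> T x = 16.
  move=> xU; rewrite /T (eq_bigr (fun=> 1)) ?sumr_const ?cardU // => u uU.
  rewrite (_ : f u x = 0) ?chi0 //.
  by rewrite /polar !sU ?rpredD // !subr0.
(* Either some [y] in [U] is not orthogonal to [x] and the sum vanishes, or every term is 1. *)
have T_ge0 x : 0 <= T x.
  have [/existsP[y /andP[yU fyx]] | noy] := boolP [exists y, (y \in U) && (f y x != 0)].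
    rewrite /T (sum_chi_shift q_quad _ fyx) // => u; exact: rpredDr.
  apply: sumr_ge0 => u uU; rewrite chiE ifT // -[_ == _]negbK.
  by apply: contra noy => fux; apply/existsP; exists u; rewrite uU.
have sumT : \sum_x T x = 256.
  have E (u : 'rV_8) : u \in U -> \sum_x chi (f u x) = if u == 0 then 256 else 0.
    by move=> _; under eq_bigr do rewrite polarC; exact: sum_chi_polar.
  rewrite exchange_big /= (eq_bigr _ E) -big_mkcondr /= (big_pred1 0) // => u /=.
  by case: eqP => [->|_]; rewrite ?mem0v ?andbF.
(* The 16 vectors of [U] already contribute 16 * 16 = 256, the whole of [sumT]; the remaining terms
   are nonnegative, hence zero. *)
have T0 x : x \notin U -> T x = 0.
  suff sum0 : \sum_(y | y \notin U) T y = 0.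
    by move=> xU; exact: (psumr_eq0P (fun y _ => T_ge0 y) sum0 xU).
  move: sumT; rewrite (bigID (mem U)) /= (eq_bigr _ TU) sumr_const cardU => sumT.
  by apply: (addrI (16 *+ 16)); rewrite sumT addr0 -mulrnA.
have : \sum_(u in U) \sum_x chi (q x) = 16 *+ 16.
  transitivity (\sum_(u in U) \sum_x chi (q x) * chi (f u x)).
    apply: eq_bigr => u uU; rewrite (reindex_inj (addIr u)); apply: eq_bigr => x _.
    by rewrite -chiD quadD // (sU u uU) addr0 polarC.
  rewrite exchange_big /= (bigID (mem U)) /= [X in _ + X]big1 ?addr0.
    under eq_bigr => x xU do rewrite (sU x xU) chi0 -mulr_sumr -/(T x) TU // mul1r.
    by rewrite sumr_const cardU -mulrnA.
  by move=> x xU; rewrite -mulr_sumr -/(T x) T0 // mulr0.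
by rewrite sumr_const cardU; move/eqP; rewrite eqrMn2r // => /eqP.
Qed.

(** Completing the square: q(x) + f(x, u) = q(x + u) + q(u) over F_2. *)
Lemma sum_chi_quad_polar u : \sum_x chi (q x) * chi (f x u) = 16 * chi (q u).
Proof.
rewrite -sum_chi_quad mulr_suml (reindex_inj (addIr u)); apply: eq_bigr => x _.
rewrite -!chiD quadD // polarDl // polarxx // addr0; congr chi.
by rewrite -[LHS]addrA F2_addrr addr0.
Qed.

(** The indicator of q(x) = 1 is (1 - chi(q(x))) / 2, so this is half the difference of the two
    preceding full sums. *)
Lemma sum_chi_nonsingular u :
  \sum_(x | q x == 1) chi (f x u) = (u == 0)%:R * 128 - 8 * chi (q u).
Proof.
have -> : \sum_(x | q x == 1) chi (f x u)
    = \sum_x (2^-1 * chi (f x u) - 2^-1 * (chi (q x) * chi (f x u))).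
  rewrite big_mkcond; apply: eq_bigr => x _; rewrite [chi (q x)]chiE -F2_neq0.
  by case: (q x == 0) => /=; field.
rewrite sumrB -!mulr_sumr sum_chi_quad_polar sum_chi_polar.
by case: (u == 0) => /=; field.
Qed.

Lemma card_nonsingular : #|[set x | q x == 1]| = 120%N.
Proof.
have := sum_chi_nonsingular 0; rewrite eqxx quad0 // chi0.
under eq_bigr do rewrite polar0r // chi0.
rewrite sumr_const => e; apply/eqP; rewrite -(eqr_nat algC) cardsE e; apply/eqP => /=; ring.
Qed.

Lemma sum_chi_nonsingular1 v : q v = 1 -> \sum_(x | q x == 1) chi (f x v) = 8.
Proof.
move=> qv; rewrite sum_chi_nonsingular qv chi1.
have /negbTE-> : v != 0 by apply: contra_eqN qv => /eqP->; rewrite quad0.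
by rewrite mul0r; ring.
Qed.

(** The summand is chi(f(x, v + w)), and q(v + w) = f(v, w) because q(v) + q(w) = 0; this gives the
    entries of K^2. *)
Lemma sum_chi_nonsingular2 v w : q v = 1 -> q w = 1 ->
  \sum_(x | q x == 1) chi (f v x) * chi (f x w) = (v == w)%:R * 128 - 8 * chi (f v w).
Proof.
move=> qv qw; under eq_bigr do rewrite [f v _]polarC -chiD -polarDr //.
rewrite sum_chi_nonsingular quadD // qv qw F2_addrr add0r.
rewrite addr_eq0 (_ : - w = w) //.
by apply/eqP; rewrite eq_sym -addr_eq0 F2_rV_addrr.
Qed.
End PlusType.

(** * Transvections *)

Section Transvections.
Variable q : 'rV['F_2]_8 -> 'F_2.
Hypothesis qO : form_O8plus2 q.
Local Notation f := (polar q).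
Let q_quad : quadratic_form q. Proof. by case: qO. Qed.

Definition is_transvection (v : 'rV['F_2]_8) (g : {'GL_8['F_2]}) : Prop :=
  forall x : 'rV['F_2]_8, x *m GLval g = x + f x v *: v.

Lemma GL_mulmx_inj (g g' : {'GL_8['F_2]}) :
  (forall x : 'rV['F_2]_8, x *m GLval g = x *m GLval g') -> g = g'.
Proof.
by move=> e; apply: val_inj; apply/row_matrixP => i; rewrite !rowE; exact: e.
Qed.

(** At an [x] not orthogonal to [v], the displacement of [x] under [g] is [v] itself, as 1 is the
    only nonzero scalar. *)
Lemma transvection_inj v w g :
  v != 0 -> is_transvection v g -> is_transvection w g -> v = w.
Proof.
move=> v0 tv tw; have [x fxv] := polar_neq0 qO v0.
have := tv x; rewrite tw => /addrI; rewrite [f x v]F2_natE fxv scale1r.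
rewrite [f x w]F2_natE; case: (f x w != 0); rewrite ?scale1r ?scale0r // => e.
by rewrite -e eqxx in v0.
Qed.

Lemma transvection_exists v : exists g, is_transvection v g.
Proof.
pose h := fun x : 'rV['F_2]_8 => x + f x v *: v.
have h_lin : linear h.
  move=> a x y; rewrite /h polarDl // polarZl // scalerDl scalerDr scalerA.
  by rewrite -!addrA; congr (_ + _); rewrite addrCA.
pose hL : {linear 'rV['F_2]_8 -> 'rV['F_2]_8} := HB.pack h (GRing.isLinear.Build _ _ _ _ h h_lin).
have hE x : x *m lin1_mx h = h x by rewrite (mul_rV_lin1 hL).
have hh x : h (h x) = x.
  rewrite /h polarDl // polarZl // polarxx // mulr0 addr0 -addrA -scalerDl.
  by rewrite F2_addrr scale0r addr0.
have hmx : lin1_mx h *m lin1_mx h = 1%:M.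
  by apply/row_matrixP => i; rewrite row_mul !rowE !hE hh mulmx1.
have h_unit : lin1_mx h \is a GRing.unit by have [] := mulmx1_unit hmx.
by exists (FinRing.unit _ h_unit) => x; exact: hE.
Qed.

Lemma transvection_sqr v g : is_transvection v g -> (g * g)%g = 1%g.
Proof.
move=> tv; apply: GL_mulmx_inj => x; rewrite GL_ME GL_1E mulmxA !tv mulmx1.
rewrite polarDl // polarZl // polarxx // mulr0 addr0 -addrA -scalerDl.
by rewrite F2_addrr scale0r addr0.
Qed.

(** For involutions the condition says that [g] and [g'] commute. If f(v, w) = 1, then [g * g']
    sends v to v + w while [g' * g] sends it to w. *)
Lemma transvectionM_sqr v w g g' : v != 0 ->
  is_transvection v g -> is_transvection w g' ->
  ((g * g') * (g * g') == 1)%g = (f v w == 0).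
Proof.
move=> v0 tv tw.
have -> : ((g * g') * (g * g') == 1)%g = (g * g' == g' * g)%g.
  rewrite -(inj_eq (mulIg (g' * g)%g)) mul1g -!mulgA [(g' * (g' * g))%g]mulgA.
  by rewrite (transvection_sqr tw) mul1g (transvection_sqr tv) mulg1.
apply/eqP/eqP => [e | fvw].
  have := congr1 (fun g : {'GL_8['F_2]} => v *m GLval g) e.
  rewrite !GL_ME !mulmxA tv polarxx // scale0r addr0 tw mulmxDl -scalemxAl !tv.
  rewrite polarxx // scale0r addr0 => /addrI; have [//|fvw] := eqVneq (f v w) 0.
  rewrite [f w v]polarC [f v w]F2_natE fvw !scale1r -[X in X = _]addr0 => /addrI e0.
  by rewrite -e0 eqxx in v0.
apply: GL_mulmx_inj => x; rewrite !GL_ME !mulmxA tv tw !mulmxDl -!scalemxAl !tv !tw.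
rewrite fvw [f w v]polarC fvw !scale0r !addr0; exact: addrAC.
Qed.
End Transvections.

Lemma transvectionsP q g :
  reflect (exists2 v, q v = 1 & is_transvection q v g) (g \in transvections q).
Proof.
rewrite inE; apply: (iffP existsP) => [[v /andP[/eqP qv /forallP tv]] | [v qv tv]].
  by exists v => // x; apply/eqP.
by exists v; rewrite qv eqxx; apply/forallP => x; apply/eqP.
Qed.

Lemma nonsingular_neq0 q v : form_O8plus2 q -> q v = 1 -> v != 0.
Proof. by case=> q_quad _ _; apply: contra_eqN => /eqP->; rewrite quad0. Qed.

(** The label of d is the vector of the transvection that d induces through G -> G / N -> (G / N) /
    Z. As Z separates no two elements of D / N into a common coset, equal labels mean equal cosets
    of N, which gives the fibre size. *)
Lemma transvection_labelling h (gT : finGroupType) (G : {group gT}) (D : {set gT}) :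
    three_transposition_group G D -> type_3h_2_O8plus2 h G D ->
  exists q (phi : gT -> 'rV['F_2]_8),
    [/\ form_O8plus2 q,
        forall d, d \in D -> q (phi d) = 1,
        forall v, q v = 1 -> #|[set d in D | phi d == v]| = (3 ^ h)%N
      & forall d e, d \in D -> e \in D ->
          diagram d e = (d != e) && ((phi d == phi e) || (polar q (phi d) (phi e) != 0))].
Proof.
move=> [_ genD ord2 ord123] [N [nNG pN cardDN [[Z [ZZ _ _ injE [q qO [f isof imf]]]] _]]].
have DG d : d \in D -> d \in G by rewrite -genD; exact: (subsetP (subset_gen D)).
have nN x : x \in G -> x \in 'N(N) by exact: (subsetP (normal_norm nNG)).
have nZ x : x \in (G / N)%g -> x \in 'N(Z).
  by apply/subsetP/normal_norm; exact: sub_center_normal.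
pose psi x := f (coset Z (coset N x)).
have GN x : x \in G -> coset N x \in (G / N)%g by move=> Gx; apply: mem_quotient.
have GNZ x : x \in G -> coset Z (coset N x) \in (G / N / Z)%g.
  by move=> Gx; apply: mem_quotient; exact: GN.
have psiM : {in G &, {morph psi : x y / (x * y)%g}}.
  by move=> x y Gx Gy; rewrite /psi !morphM ?GNZ ?nN ?nZ ?GN.
have psi1 : psi 1%g = 1%g by rewrite /psi !morph1.
have DN d : d \in D -> coset N d \in (D / N)%g by move=> Dd; apply: mem_morphim; rewrite ?nN ?DG.
have psi_trans d : d \in D -> exists2 v, q v = 1 & is_transvection q v (psi d).
  move=> Dd; apply/transvectionsP; rewrite -imf; apply: imset_f.
  by apply: mem_morphim; [rewrite nZ ?GN ?DG | exact: DN].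
have [phi phiP] : exists phi, forall d, d \in D ->
    q (phi d) = 1 /\ is_transvection q (phi d) (psi d).
  pose P d v := (q v == 1) && [forall x, x *m GLval (psi d) == x + polar q x v *: v].
  (* The default 0 is never reached on [D], where a suitable vector always exists. *)
  exists (fun d => odflt 0 [pick v | P d v]) => d /psi_trans[v qv tv].
  case: pickP => [w /andP[/eqP qw /forallP tw] | /(_ v)].
    by split=> // x; apply/eqP.
  by rewrite /P qv eqxx /=; case/forallP => x; apply/eqP.
have phi0 d : d \in D -> phi d != 0 by case/phiP => qd _; exact: nonsingular_neq0 qO qd.
have phi_psi d e : d \in D -> e \in D -> (phi d = phi e) <-> (psi d = psi e).
  move=> Dd De; have [[_ td] [_ te]] := (phiP d Dd, phiP e De); split=> eq_de.
    by apply: GL_mulmx_inj => x; rewrite td te eq_de.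
  by apply: (transvection_inj qO (phi0 d Dd) td); rewrite eq_de.
have phi_coset d e : d \in D -> e \in D -> (phi e == phi d) = (e \in (d *: N)%g).
  move=> Dd De; have [Gd Ge] := (DG d Dd, DG e De).
  have -> : (e \in (d *: N)%g) = (coset N e == coset N d).
    rewrite -norm_rlcoset ?nN //.
    exact: (sameP (rcoset_kercosetP (nN e Ge) (nN d Gd)) eqP).
  apply/eqP/eqP => [/phi_psi eq_psi|eqN]; last by apply/phi_psi => //; rewrite /psi eqN.
  apply: injE; rewrite ?DN //.
  by apply: (injmP (isom_inj isof)); rewrite ?GNZ //; exact: eq_psi.
exists q, phi; split=> // [d /phiP[] // | v qv | d e Dd De].
  (* Every nonsingular [v] is the label of some d in [D], since [D] maps onto all transvections; its
     fibre is then the part of [D] in the coset d N. *)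
  have [g tv] := transvection_exists qO v.
  have : g \in transvections q by apply/transvectionsP; exists v.
  rewrite -imf => /imsetP[_ /morphimP[_ _ /morphimP[d _ Dd ->] ->] gE].
  have vE : v = phi d.
    apply: (transvection_inj qO _ tv); first exact: nonsingular_neq0 qO qv.
    by rewrite gE; case: (phiP d Dd).
  rewrite -(cardDN d Dd); apply: eq_card => e; rewrite !inE.
  by case De: (e \in D); rewrite //= vE phi_coset.
have sqr x : x \in D -> (x * x = 1)%g by move=> Dx; have := expg_order x; rewrite ord2.
rewrite /diagram; have [<-|neq_de /=] := eqVneq d e; first by rewrite sqr // order1.
have ord1 : #[d * e]%g != 1%N.
  rewrite order_eq1; apply: contra_neqN neq_de => /eqP de1.
  by apply: (mulgI d); rewrite de1 sqr.
have [Gd Ge] := (DG d Dd, DG e De).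
have [eq_phi | neq_phi] /= := eqVneq (phi d) (phi e).
  (* Here d * e = d^-1 * e lies in the 3-group [N] and is not 1, which excludes order 2. *)
  have : e \in (d *: N)%g by rewrite -phi_coset // eq_phi.
  rewrite mem_lcoset (_ : d^-1 = d)%g; last by apply: (mulgI d); rewrite mulgV sqr.
  move=> /(mem_p_elt pN); rewrite /p_elt; have := ord123 d e Dd De.
  by rewrite !inE (negbTE ord1) /= => /orP[] /eqP->.
have [[_ td] [_ te]] := (phiP d Dd, phiP e De).
rewrite -(transvectionM_sqr qO (phi0 d Dd) td te) -!psiM ?groupM //.
have := ord123 d e Dd De; rewrite !inE (negbTE ord1) /=.
case/orP => /eqP ord_de; rewrite ord_de /=; have := expg_order (d * e)%g; rewrite ord_de.
  by move=> de2; rewrite [(_ * _)%g]de2 psi1 eqxx.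
(* If the image of d * e had trivial square as well as trivial cube, it would be 1, and the labels
   would coincide. *)
move=> de3; apply/esym; apply: contra_neqN neq_phi => /eqP psi2; apply/phi_psi => //.
have psi3 : psi (d * e * (d * e) * (d * e))%g = 1%g.
  by rewrite -[RHS]psi1 -de3 !expgS expg0 mulg1 !mulgA.
move: psi3; rewrite psiM ?groupM // psi2 mul1g psiM // => psi1'.
by apply: (mulgI (psi d)); rewrite psi1' -psiM // sqr.
Qed.

(** * The adjacency matrix *)

Section Blowup.
Variables (gT : finGroupType) (D : {set gT}) (c : nat).
Variables (q : 'rV['F_2]_8 -> 'F_2) (phi : gT -> 'rV['F_2]_8).
Hypothesis c_gt0 : (0 < c)%N.
Hypothesis qO : form_O8plus2 q.
Hypothesis q_phi : forall d, d \in D -> q (phi d) = 1.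
Hypothesis card_fiber : forall v, q v = 1 -> #|[set d in D | phi d == v]| = c.
Hypothesis diagramE : forall d e, d \in D -> e \in D ->
  diagram d e = (d != e) && ((phi d == phi e) || (polar q (phi d) (phi e) != 0)).

Local Notation f := (polar q).
Let q_quad : quadratic_form q. Proof. by case: qO. Qed.

(** This reduces row sums and matrix products over [D] to character sums over the nonsingular
    vectors. *)
Lemma sum_fibers (F : 'rV['F_2]_8 -> algC) :
  \sum_(d in D) F (phi d) = c%:R * \sum_(v | q v == 1) F v.
Proof.
rewrite (partition_big phi (fun v => q v == 1)) /=; last by move=> d Dd; rewrite q_phi.
rewrite mulr_sumr; apply: eq_bigr => v /eqP qv.
rewrite (eq_bigr (fun=> F v)); last by move=> d /andP[_ /eqP->].
by rewrite sumr_const mulr_natl -(card_fiber qv) cardsE.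
Qed.

Lemma sum_fibers_ord (F : 'rV['F_2]_8 -> algC) :
  \sum_(i < #|D|) F (phi (enum_val i)) = c%:R * \sum_(v | q v == 1) F v.
Proof. by rewrite -sum_fibers [RHS]big_enum_val. Qed.

Lemma card_blowup : #|D| = (120 * c)%N.
Proof.
apply/eqP; rewrite -(eqr_nat algC) -sumr_const (sum_fibers (fun=> 1)) sumr_const.
by rewrite -cardsE (card_nonsingular qO) -natrM mulnC.
Qed.

Lemma blowup_entry d e : d \in D -> e \in D ->
  ((diagram d e)%:R + (d == e)%:R : algC)
    = (phi d == phi e)%:R + 2^-1 * (1 - chi (f (phi d) (phi e))).
Proof.
move=> Dd De; rewrite diagramE // chiE.
have [<-|_] := eqVneq d e; first by rewrite eqxx polarxx //=; field.
have [<-|_] := eqVneq (phi d) (phi e); first by rewrite polarxx //=; field.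
by case: (f _ _ == 0) => /=; field.
Qed.

Lemma blowup_degree d : d \in D -> #|[set e in D | diagram d e]| = (57 * c - 1)%N.
Proof.
(* Adding 1 removes the truncated subtraction and turns the degree into a row sum of adjacency
   matrix plus identity, namely c (1 + (120 - 8) / 2) = 57 c. *)
move=> Dd; apply/eqP; rewrite -(eqn_add2r 1) subnK ?muln_gt0 //.
rewrite -(eqr_nat algC) natrD cardsE -sum1_card natr_sum.
have -> : \sum_(e in [pred e | (e \in D) && diagram d e]) 1%:R
    = \sum_(e in D) (diagram d e)%:R :> algC.
  by rewrite big_mkcondr; apply: eq_bigr => e _; case: (diagram d e).
have e1 : 1%:R = \sum_(e in D) (d == e)%:R :> algC.
  rewrite (bigD1 d) //= eqxx big1 ?addr0 // => e /andP[_ /negbTE].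
  by rewrite eq_sym => ->.
rewrite [X in _ + X]e1 -big_split /= (eq_bigr _ (fun e => @blowup_entry d e Dd)).
rewrite (sum_fibers (fun v => (phi d == v)%:R + 2^-1 * (1 - chi (f (phi d) v)))).
rewrite big_split -mulr_sumr sumrB sumr_const -cardsE (card_nonsingular qO) /=.
under [X in _ - X]eq_bigr do rewrite polarC.
rewrite (sum_chi_nonsingular1 qO (q_phi Dd)) (bigD1 (phi d)) ?q_phi //= eqxx.
rewrite big1 => [|v /andP[_ /negbTE]]; last by rewrite eq_sym => ->.
by rewrite natrM; apply/eqP => /=; field.
Qed.

Lemma blowup_char_poly :
  exists2 m, #|D| = (120 + m)%N &
    char_poly (diagram_adjmx D)
      = ('X - (57 * c%:R - 1)%:P) * ('X - (9 * c%:R - 1)%:P) ^+ 35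
        * ('X - (- (3 * c%:R) - 1)%:P) ^+ 84 * ('X + 1) ^+ m.
Proof.
have c0 : c%:R != 0 :> algC by rewrite pnatr_eq0 -lt0n.
pose w (i : 'I_#|D|) := phi (enum_val i).
have qw i : q (w i) = 1 by apply: q_phi; exact: enum_valP.
(* The scalars are those required by [char_poly_projections]. *)
pose P := c%:R^-1 *: \matrix_(i, j) (w i == w j)%:R : 'M[algC]_#|D|.
pose K := c%:R^-1 *: \matrix_(i, j) chi (f (w i) (w j)) : 'M[algC]_#|D|.
pose J := (120 * c%:R)^-1 *: const_mx 1 : 'M[algC]_#|D|.
(* Entries depending only on labels multiply as kernels on the nonsingular vectors, up to the factor
   [c]. *)
have mulF (A B : 'rV_8 -> 'rV_8 -> algC) a b i j :
    ((a *: \matrix_(i, j) A (w i) (w j)) *m (b *: \matrix_(i, j) B (w i) (w j))) i j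
      = a * b * c%:R * \sum_(v | q v == 1) A (w i) v * B v (w j).
  rewrite -scalemxAl -scalemxAr !mxE -!mulrA; congr (_ * (_ * _)).
  rewrite -(sum_fibers_ord (fun v => A (w i) v * B v (w j))).
  by apply: eq_bigr => k _; rewrite !mxE.
have JE : J = (120 * c%:R)^-1 *: \matrix_(i, j) 1.
  by congr (_ *: _); apply/matrixP => i j; rewrite !mxE.
have sum_eql i (F : 'rV_8 -> algC) : \sum_(v | q v == 1) (w i == v)%:R * F v = F (w i).
  rewrite (bigD1 (w i)) ?qw //= eqxx mul1r big1 ?addr0 // => v /andP[_ /negbTE].
  by rewrite eq_sym => ->; rewrite mul0r.
have sum_eqr i (F : 'rV_8 -> algC) : \sum_(v | q v == 1) F v * (v == w i)%:R = F (w i).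
  by rewrite -[RHS](sum_eql i); apply: eq_bigr => v _; rewrite mulrC eq_sym.
have sumK i : \sum_(v | q v == 1) chi (f v (w i)) = 8 by exact: sum_chi_nonsingular1.
have sum1 : \sum_(v | q v == 1) 1 = 120 :> algC.
  by rewrite sumr_const -cardsE (card_nonsingular qO).
have [] // := @char_poly_projections algC #|D| P J K c%:R.
- apply/matrixP => i j; rewrite (mulF (fun v w => (v == w)%:R) (fun v w => (v == w)%:R)).
  by rewrite sum_eql !mxE; field.
- apply/matrixP => i j; rewrite JE (mulF (fun v w => 1) (fun v w => 1)) !mxE.
  by under eq_bigr do rewrite mulr1; rewrite sum1; field.
- apply/matrixP => i j; rewrite JE (mulF (fun v w => (v == w)%:R) (fun v w => 1)).
  by rewrite sum_eql !mxE; field.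
- apply/matrixP => i j; rewrite JE (mulF (fun v w => 1) (fun v w => (v == w)%:R)).
  by rewrite sum_eqr !mxE; field.
- apply/matrixP => i j; rewrite (mulF (fun v w => (v == w)%:R) (fun v w => chi (f v w))).
  by rewrite sum_eql !mxE; field.
- apply/matrixP => i j; rewrite (mulF (fun v w => chi (f v w)) (fun v w => (v == w)%:R)).
  by rewrite sum_eqr !mxE; field.
- apply/matrixP => i j; rewrite JE (mulF (fun v w => 1) (fun v w => chi (f v w))) !mxE.
  by under eq_bigr do rewrite mul1r; rewrite sumK; field.
- apply/matrixP => i j; rewrite JE (mulF (fun v w => chi (f v w)) (fun v w => 1)) !mxE.
  by under eq_bigr do rewrite mulr1 polarC; rewrite sumK; field.
- apply/matrixP => i j; rewrite (mulF (fun v w => chi (f v w)) (fun v w => chi (f v w))) !mxE.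
  by rewrite (sum_chi_nonsingular2 qO) //; field.
(* For the three traces: all diagonal entries are 1 before scaling, as f(v, v) = 0, and there are
   120 c of them. *)
- rewrite linearZ /= /mxtrace (eq_bigr (fun=> 1)) => [|i _]; last by rewrite mxE eqxx.
  by rewrite sumr_const card_ord card_blowup natrM; field.
- rewrite linearZ /= /mxtrace (eq_bigr (fun=> 1)) => [|i _]; last by rewrite mxE.
  by rewrite sumr_const card_ord card_blowup natrM; field.
- rewrite linearZ /= /mxtrace (eq_bigr (fun=> 1)) => [|i _]; last by rewrite mxE polarxx.
  by rewrite sumr_const card_ord card_blowup natrM; field.
move=> m cardD cp; exists m => //; rewrite -cp; congr char_poly.
(* The identity entry is added and subtracted so that [blowup_entry] applies. *)
apply/matrixP => i j; rewrite !mxE -[LHS](addrK ((i == j)%:R)).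
congr (_ - _).
by rewrite -(inj_eq enum_val_inj) blowup_entry ?enum_valP // -/(w i) -/(w j); field.
Qed.

End Blowup.

Theorem proposition6p16 (h : nat) (gT : finGroupType)
    (G : {group gT}) (D : {set gT})
    (tGD : three_transposition_group G D)
    (typeGD : type_3h_2_O8plus2 h G D) :
  #|D| = (120 * 3 ^ h)%N /\
  diagram_spectrum D (57 * 3 ^+ h - 1)
    [:: (3 ^+ h.+2 - 1, 35%N); (- 3 ^+ h.+1 - 1, 84%N)] (- 1).
Proof.
have [q [phi [qO q_phi card_fiber diagramE]]] := transvection_labelling tGD typeGD.
have c_gt0 : (0 < 3 ^ h)%N by rewrite expn_gt0.
split; first exact: card_blowup qO q_phi card_fiber.
split=> [d Dd|].
  rewrite (blowup_degree c_gt0 qO q_phi card_fiber diagramE Dd).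
  by rewrite -subzn ?muln_gt0 // -(natz (57 * _)) natrM natrX.
have [m cardD ->] := blowup_char_poly c_gt0 qO q_phi card_fiber diagramE.
(* The starred multiplicity is [m] = #|D| - 120, because 1 + 35 + 84 = 120. *)
exists m; split; first by rewrite cardD /= size_nseq.
rewrite big_cons big_cat /flatten [foldr _ _ _]catA cats0 big_cat !big_nseq !iter_mulr_1.
have -> : 57 * (3 ^ h)%:R - 1 = (57 * 3 ^+ h - 1)%:~R :> algC.
  by rewrite rmorphB rmorphM rmorphXn /= natrX.
have -> : 9 * (3 ^ h)%:R - 1 = (3 ^+ h.+2 - 1)%:~R :> algC.
  by rewrite rmorphB rmorphXn /= natrX !exprS mulrA -natrM.
have -> : - (3 * (3 ^ h)%:R) - 1 = (- 3 ^+ h.+1 - 1)%:~R :> algC.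
  by rewrite rmorphB rmorphN rmorphXn /= natrX exprS.
have -> : 'X + 1 = 'X - ((-1)%:~R)%:P :> {poly algC} by rewrite !rmorphN opprK !rmorph1.
by rewrite -[LHS]mulrA -[LHS]mulrA; congr (_ * _); exact: mulrA.
Qed.
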